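(* Let $\mathcal{X}$ be a finite set, $\pi\in\mathcal{P}(\mathcal{X})$, and let $M,L\in\mathcal{L}$ be transition matrices on $\mathcal{X}$. Then: (i) $\mathrm{Hel}^2(M,L)\le R_{1/2}(M\|L)\le R_1(M\|L)\le R_2(M\|L)\le \chi^2(M\|L)$. (ii) (Pinsker's inequality) For every $0<\alpha\le 1$, $$\frac{\alpha}{2}\,\mathrm{TV}^2(M,L)\le R_\alpha(M\|L).$$
   Context: $\mathcal{P}(\mathcal{X})$ is the set of probability mass functions on the finite set $\mathcal{X}$, and $\mathcal{L}=\mathcal{L}(\mathcal{X})$ is the set of transition (row-stochastic) matrices on $\mathcal{X}$. All divergences are with respect to the given $\pi$. For $f$ convex on $(0,\infty)$ with $f(1)=0$, $D_f(M\|L):=\sum_{x}\pi(x)\sum_{y}L(x,y)f\left(\frac{M(x,y)}{L(x,y)}\right)$, with conventions $0f(0/0)=0$, $0f(a/0)=a\lim_{u\to0^+}uf(1/u)$ for $a>0$, $f(0)=\lim_{t\to 0^+}f(t)$, and $0\cdot\infty=0$. Then $\mathrm{Hel}^2$, $\chi^2$, $\mathrm{TV}$ are $D_f$ with $f(t)=(\sqrt t-1)^2$, $(t-1)^2$, $|t-1|/2$ respectively; explicitly $\mathrm{Hel}^2(M,L)=\sum_{x,y}\pi(x)(\sqrt{M(x,y)}-\sqrt{L(x,y)})^2$; $\mathrm{TV}(M,L)=\frac12\sum_{x,y}\pi(x)|M(x,y)-L(x,y)|$; $\chi^2(M\|L)=\sum_{L(x,y)>0}\pi(x)\frac{(M(x,y)-L(x,y))^2}{L(x,y)}$,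 with value $+\infty$ if $\pi(x)M(x,y)>0=L(x,y)$ for some $(x,y)$. For $\alpha\in(0,1)\cup(1,\infty)$, the Rényi divergence is $R_\alpha(M\|L):=\frac{1}{\alpha-1}\ln\sum_{x,y}\pi(x)L(x,y)\left(\frac{M(x,y)}{L(x,y)}\right)^\alpha$, where the term $L(M/L)^\alpha$ is read as $0$ if $M(x,y)=0$, and, if $L(x,y)=0<M(x,y)$, as $0$ when $\alpha<1$ and $+\infty$ when $\alpha>1$; $\ln 0=-\infty$. $R_1(M\|L):=D_{KL}(M\|L)=\sum_{x,y}\pi(x)M(x,y)\ln\frac{M(x,y)}{L(x,y)}$, with $0\ln(0/b)=0$ and $a\ln(a/0)=+\infty$ for $a>0$. *)

(* Defs.v *)
From mathcomp Require Import all_boot all_order all_algebra.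
From mathcomp Require Import all_classical all_reals all_analysis.

Set Implicit Arguments.
Unset Strict Implicit.
Unset Printing Implicit Defensive.

Import Order.TTheory GRing.Theory Num.Theory.
Import numFieldNormedType.Exports.

Local Open Scope classical_set_scope.
Local Open Scope ring_scope.

Definition is_pmf (R : realType) (X : finType) (p : X -> R) : Prop :=
  (forall x, 0 <= p x) /\ \sum_(x : X) p x = 1.

Definition is_transition_matrix (R : realType) (X : finType) (M : X -> X -> R)
    : Prop :=
  forall x, is_pmf (M x).

(* All divergences are extended-real valued.  In [\bar R], [0 * +oo = 0] and
   [0 < a] implies [a%:E * +oo = +oo], which are the conventions needed here. *)

(* [l f(m / l)] with [f(0)] the right limit at [0],
   [0 f(0 / 0) = 0] and [0 f(a / 0) = a lim_{u -> 0+} u f(1 / u)].  Only the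
   values of [f] on the positive reals matter. *)
Definition f_div_term (R : realType) (f : R -> R) (m l : R) : \bar R :=
  let f0 : \bar R := lim ((f t)%:E @[t --> 0^'+]) in
  let finf : \bar R := lim ((u * f u^-1)%:E @[u --> 0^'+]) in
  if l == 0 then if m == 0 then 0%E else (m%:E * finf)%E
  else (l%:E * (if (m == 0)%R then f0 else (f (m / l))%:E))%E.

(* Meant for [f] convex on the positive reals with [f 1 = 0]; both limits in
   [f_div_term] then exist and differ from [-oo]. *)
Definition f_div (R : realType) (X : finType) (f : R -> R) (p : X -> R)
    (M L : X -> X -> R) : \bar R :=
  (\sum_(x : X) (p x)%:E * \sum_(y : X) f_div_term f (M x y) (L x y))%E.

Definition Hel2 (R : realType) (X : finType) (p : X -> R) (M L : X -> X -> R) :=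
  f_div (fun t : R => (Num.sqrt t - 1) ^+ 2) p M L.

Definition chi2 (R : realType) (X : finType) (p : X -> R) (M L : X -> X -> R) :=
  f_div (fun t : R => (t - 1) ^+ 2) p M L.

Definition TV (R : realType) (X : finType) (p : X -> R) (M L : X -> X -> R) :=
  f_div (fun t : R => `|t - 1| / 2) p M L.

Definition KL_term (R : realType) (m l : R) : \bar R :=
  if m == 0 then 0%E else if l == 0 then +oo%E else (m * ln (m / l))%:E.

Definition KL (R : realType) (X : finType) (p : X -> R) (M L : X -> X -> R)
    : \bar R :=
  (\sum_(x : X) \sum_(y : X) (p x)%:E * KL_term (M x y) (L x y))%E.

Definition renyi_term (R : realType) (a m l : R) : \bar R :=
  if m == 0 then 0%E
  else if l == 0 then (if a < 1 then 0%E else +oo%E)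
  else (l * (m / l) `^ a)%:E.

(* [lne] is the extended logarithm: [lne 0 = -oo] and [lne +oo = +oo]. *)
Definition renyi (R : realType) (X : finType) (a : R) (p : X -> R)
    (M L : X -> X -> R) : \bar R :=
  if a == 1 then KL p M L
  else ((a - 1)^-1%:E *
        lne (\sum_(x : X) \sum_(y : X)
               (p x)%:E * renyi_term a (M x y) (L x y)))%E.

Section closed_forms.
Context (R : realType) (X : finType).
Implicit Types (f g : R -> R) (p : X -> R) (M L : X -> X -> R).

Lemma lim_right0 f g : (forall u, 0 < u -> f u = g u) ->
  {for 0, continuous g} -> lim ((f u)%:E @[u --> 0^'+]) = (g 0)%:E.
Proof.
move=> fg cg; apply/cvg_lim => //.
have gg0 : (g u)%:E @[u --> 0^'+] --> (g 0)%:E.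
  by apply: cvg_EFin; [exact: nearW|exact/cvg_at_right_filter/cg].
apply: cvg_trans gg0; apply: near_eq_cvg; near=> u; rewrite fg//.
Unshelve. all: by end_near. Qed.

Lemma sqrB1_continuous : {for 0, continuous (fun t : R => (t - 1) ^+ 2)}.
Proof.
apply: (@continuous_comp _ _ _ (fun t : R => t - 1) (fun t => t ^+ 2)).
  by apply: cvgB; [exact: cvg_id|exact: cvg_cst].
exact: exprn_continuous.
Qed.

Lemma normB1_continuous : {for 0, continuous (fun t : R => `|t - 1| / 2)}.
Proof.
apply: cvgMr_tmp; apply: cvg_norm.
by apply: cvgB; [exact: cvg_id|exact: cvg_cst].
Qed.

Lemma sqrtB1_continuous :
  {for 0, continuous (fun t : R => (Num.sqrt t - 1) ^+ 2)}.
Proof.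
apply: (@continuous_comp _ _ _ (fun t : R => Num.sqrt t - 1) (fun t => t ^+ 2)).
  by apply: cvgB; [exact: sqrt_continuous|exact: cvg_cst].
exact: exprn_continuous.
Qed.

Lemma f_div_term_TV (m l : R) : 0 <= m -> 0 <= l ->
  f_div_term (fun t : R => `|t - 1| / 2) m l = (`|m - l| / 2)%:E.
Proof.
move=> m0 l0; rewrite /f_div_term.
have [->|lN0] := eqVneq l 0.
  have [->|mN0] := eqVneq m 0; first by rewrite subrr normr0 mul0r.
  rewrite (@lim_right0 _ (fun u => `|u - 1| / 2)); last first.
  - exact: normB1_continuous.
  - move=> u u0; rewrite mulrA -{1}(gtr0_norm u0) -normrM mulrBr mulr1.
    by rewrite divff ?gt_eqF// distrC.
  by rewrite -EFinM sub0r normrN normr1 subr0 (ger0_norm m0) mul1r.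
have lgt0 : 0 < l by rewrite lt_neqAle eq_sym lN0.
have [->|mN0] := eqVneq m 0.
  rewrite (@lim_right0 _ (fun u => `|u - 1| / 2))//; last first.
    exact: normB1_continuous.
  by rewrite -EFinM !sub0r !normrN normr1 (ger0_norm l0) mul1r.
by rewrite -EFinM mulrA -{1}(gtr0_norm lgt0) -normrM mulrBr mulr1 mulrCA divff// mulr1.
Qed.

Lemma f_div_term_Hel2 (m l : R) : 0 <= m -> 0 <= l ->
  f_div_term (fun t : R => (Num.sqrt t - 1) ^+ 2) m l =
  ((Num.sqrt m - Num.sqrt l) ^+ 2)%:E.
Proof.
move=> m0 l0; rewrite /f_div_term.
have sq u v : 0 < u -> 0 <= v ->
    u * (Num.sqrt (v / u) - 1) ^+ 2 = (Num.sqrt v - Num.sqrt u) ^+ 2.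
  move=> u0 v0; rewrite -{1}(sqr_sqrtr (ltW u0)) -exprMn mulrBr mulr1 -sqrtrM ?ltW//.
  by rewrite mulrCA divff ?gt_eqF// mulr1.
have [->|lN0] := eqVneq l 0.
  have [->|mN0] := eqVneq m 0; first by rewrite subrr expr0n.
  rewrite (@lim_right0 _ (fun u => (Num.sqrt u - 1) ^+ 2)); last first.
  - exact: sqrtB1_continuous.
  - by move=> u u0; rewrite -[u^-1]mul1r sq// sqrtr1 -sqrrN opprB.
  by rewrite -EFinM sqrtr0 sub0r sqrrN expr1n mulr1 subr0 sqr_sqrtr.
have lgt0 : 0 < l by rewrite lt_neqAle eq_sym lN0.
have [->|mN0] := eqVneq m 0.
  rewrite (@lim_right0 _ (fun u => (Num.sqrt u - 1) ^+ 2))//; last first.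
    exact: sqrtB1_continuous.
  by rewrite -EFinM sqrtr0 !sub0r !sqrrN expr1n mulr1 sqr_sqrtr.
by rewrite -EFinM sq.
Qed.

Lemma chi2_perspective_lim :
  lim ((u * (u^-1 - 1 : R) ^+ 2)%:E @[u --> 0^'+]) = +oo%E.
Proof.
apply/cvg_lim => //; apply/cvgeyPge => A; near=> u.
have u0 : 0 < u by near: u; exact: nbhs_right_gt.
have -> : u * (u^-1 - 1) ^+ 2 = u^-1 - 2 + u.
  by rewrite sqrrB1 mulrDr mulrBr mulr1 expr2 mulrA divff ?gt_eqF// mul1r mulrnAr divff ?gt_eqF.
rewrite lee_fin -[A]addr0; apply: lerD; last exact: ltW.
rewrite lerBrDr.
have uA : u < (`|A| + 2)^-1 by near: u; apply: nbhs_right_lt; rewrite invr_gt0 ltr_wpDl.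
apply: (@le_trans _ _ (`|A| + 2)); first by rewrite lerD2r ler_norm.
by rewrite ltW// -ltf_pV2 ?posrE ?invr_gt0 ?invrK// ltr_wpDl.
Unshelve. all: by end_near. Qed.

Lemma f_div_term_chi2 (m l : R) : 0 <= m -> 0 <= l ->
  f_div_term (fun t : R => (t - 1) ^+ 2) m l =
  if l == 0 then if m == 0 then 0%E else +oo%E else ((m - l) ^+ 2 / l)%:E.
Proof.
move=> m0 l0; rewrite /f_div_term.
have [_|lN0] := eqVneq l 0.
  have [//|mN0] := eqVneq m 0.
  by rewrite chi2_perspective_lim gt0_muley// lte_fin lt_neqAle eq_sym mN0.
have [->|mN0] := eqVneq m 0.
  rewrite (@lim_right0 _ (fun t => (t - 1) ^+ 2))//; last exact: sqrB1_continuous.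
  by rewrite -EFinM !sub0r !sqrrN expr1n mulr1 expr2 mulfK.
rewrite -EFinM; congr (_%:E).
apply: (mulIf lN0); rewrite divfK// mulrAC -expr2 -exprMn mulrBr mulr1.
by rewrite mulrCA divff// mulr1.
Qed.

Lemma Hel2E p M L : is_transition_matrix M -> is_transition_matrix L ->
  Hel2 p M L =
  (\sum_x \sum_y p x * (Num.sqrt (M x y) - Num.sqrt (L x y)) ^+ 2)%:E.
Proof.
move=> hM hL; rewrite /Hel2 /f_div -sumEFin; apply: eq_bigr => x _.
rewrite -mulr_sumr EFinM -sumEFin; congr (_ * _)%E; apply: eq_bigr => y _.
by rewrite f_div_term_Hel2 ?(hM x).1 ?(hL x).1.
Qed.

Lemma TVE p M L : is_transition_matrix M -> is_transition_matrix L ->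
  TV p M L = (2^-1 * \sum_x \sum_y p x * `|M x y - L x y|)%:E.
Proof.
move=> hM hL; rewrite /TV /f_div mulr_sumr -sumEFin; apply: eq_bigr => x _.
rewrite -mulr_sumr mulrCA EFinM mulr_sumr -sumEFin; congr (_ * _)%E.
apply: eq_bigr => y _.
by rewrite f_div_term_TV ?(hM x).1 ?(hL x).1// mulrC.
Qed.

Lemma chi2E p M L : is_pmf p ->
  is_transition_matrix M -> is_transition_matrix L ->
  chi2 p M L =
  if [exists x, exists y, (0 < p x * M x y) && (L x y == 0)] then +oo%E
  else (\sum_x \sum_(y | 0 < L x y) p x * ((M x y - L x y) ^+ 2 / L x y))%:E.
Proof.
move=> [p0 _] hM hL; rewrite /chi2 /f_div.
have M0 x y : 0 <= M x y by exact: (hM x).1.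
have L0 x y : 0 <= L x y by exact: (hL x).1.
have t0 x y : (0 <= f_div_term (fun t : R => ((t - 1) ^+ 2)%R) (M x y) (L x y))%E.
  rewrite f_div_term_chi2//; case: ifPn => _; first by case: ifPn.
  by rewrite lee_fin divr_ge0 ?sqr_ge0.
case: ifPn => [/existsP[x /existsP[y /andP[pM /eqP L_0]]]|].
  have Mgt0 : M x y != 0 by apply: contraTneq pM => ->; rewrite mulr0 ltxx.
  have pgt0 : 0 < p x.
    by rewrite lt_neqAle p0 andbT eq_sym; apply: contraTneq pM => ->; rewrite mul0r ltxx.
  apply/eqP; rewrite -leye_eq (bigD1 x)//= (bigD1 y)//=.
  rewrite {1}f_div_term_chi2// L_0 eqxx (negbTE Mgt0) addye; last first.
    by rewrite gt_eqF// (lt_le_trans ltNy0)// sume_ge0.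
  rewrite gt0_muley ?lte_fin// addye//.
  rewrite gt_eqF// (lt_le_trans ltNy0)// sume_ge0// => z _.
  by rewrite mule_ge0 ?lee_fin// sume_ge0.
rewrite negb_exists => /forallP H; rewrite -sumEFin; apply: eq_bigr => x _.
rewrite -mulr_sumr EFinM.
have [->|px] := eqVneq (p x) 0; first by rewrite !mul0e.
have pgt0 : 0 < p x by rewrite lt_neqAle eq_sym px p0.
congr (_ * _)%E; rewrite [in RHS]big_mkcond/= -sumEFin; apply: eq_bigr => y _.
rewrite f_div_term_chi2// lt_neqAle L0 andbT eq_sym; case: ifPn => //= L_0.
case: ifPn => // MN0; have := H x; rewrite negb_exists => /forallP/(_ y).
by rewrite [L x y == 0]eq_sym L_0 andbT mulr_gt0// lt_neqAle eq_sym MN0 M0.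
Qed.

End closed_forms.

(* Main.v *)
(** Weighting the rows by [p] turns [M] and [L] into two laws [P = p M] and
    [Q = p L] on [X * X], and every divergence depends on [(P, Q)] only.
    With [S_a = \sum Q (P / Q)^a]:
    - [Hel2 <= R_(1/2)] and [R_2 <= chi2] are [ln t <= t - 1], since
      [S_(1/2) = 1 - Hel2 / 2] and [S_2 = 1 + chi2];
    - Jensen's inequality for [ln] under [P] gives [(a - 1) KL <= ln S_a],
      hence [R_(1/2) <= R_1 <= R_2];
    - squaring the weighted AM-GM inequality between [sqrt P] and [sqrt Q] gives
      [S_a <= 1 - a (1 - a) Hel2], so [a Hel2 <= R_a]; Cauchy-Schwarz gives
      [TV^2 <= Hel2], and Pinsker's inequality follows. *)
Require Import Defs.
From mathcomp Require Import all_boot all_order all_algebra.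
From mathcomp Require Import all_classical all_reals all_analysis.
From mathcomp Require Import ring lra.

Set Implicit Arguments.
Unset Strict Implicit.
Unset Printing Implicit Defensive.

Import Order.TTheory GRing.Theory Num.Theory.

(** * Real inequalities for logarithms, powers and means *)

Section real_inequalities.
Local Open Scope ring_scope.
Context (R : realType).

Lemma ln_le_subr1 (x : R) : 0 < x -> ln x <= x - 1.
Proof.
move=> x0; have := @le_ln1Dx R (x - 1).
by rewrite addrCA subrr addr0; apply; lra.
Qed.

(** Young's inequality for the [a]-th power of [x] and [1], with conjugate exponents [1 / a] and
    [1 / (1 - a)]. *)
Lemma powR_le_tangent (a x : R) : 0 < a -> a < 1 -> 0 <= x ->
  x `^ a <= a * x + (1 - a).
Proof.
move=> a0 a1 x0.
have := @conjugate_powR R (x `^ a) 1 a^-1 (1 - a)^-1 (powR_ge0 _ _) ler01.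
rewrite !invr_gt0 subr_gt0 !invrK subrKC -powRrM divff ?gt_eqF//.
by rewrite powRr1// powR1 mulr1 mul1r mulrC; apply.
Qed.

(** With [x = sqrt P] and [y = sqrt Q], the right side is the square of [a x + (1 - a) y] and the
    left side that of [y (x / y)^a]. *)
Lemma affinity_term_le (a P Q : R) : 0 < a -> a < 1 -> 0 <= P -> 0 <= Q ->
  Q * (P / Q) `^ a <=
  a * P + (1 - a) * Q - a * (1 - a) * (Num.sqrt P - Num.sqrt Q) ^+ 2.
Proof.
move=> a0 a1 P0 Q0.
set x := Num.sqrt P; set y := Num.sqrt Q.
have x0 : 0 <= x by exact: sqrtr_ge0.
have y0 : 0 <= y by exact: sqrtr_ge0.
rewrite -(sqr_sqrtr P0) -(sqr_sqrtr Q0) -/x -/y.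
have -> : a * x ^+ 2 + (1 - a) * y ^+ 2 - a * (1 - a) * (x - y) ^+ 2 =
          (a * x + (1 - a) * y) ^+ 2 by ring.
have [->|yN0] := eqVneq y 0; first by rewrite expr0n/= mul0r sqr_ge0.
have -> : (x ^+ 2 / y ^+ 2) `^ a = (x / y) `^ a ^+ 2.
  by rewrite -expr_div_n !expr2 powRM// divr_ge0.
rewrite -exprMn lerXn2r ?nnegrE ?mulr_ge0 ?powR_ge0//.
  by rewrite addr_ge0 ?mulr_ge0 ?subr_ge0// ltW.
have -> : a * x + (1 - a) * y = y * (a * (x / y) + (1 - a)) by field.
by rewrite ler_wpM2l// powR_le_tangent// divr_ge0.
Qed.

(** The tangent to [ln] at the mean [S] gives [ln Z <= ln S - 1 + Z / S]; the average of the right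
    side under [w] is [ln S]. *)
Lemma jensen_ln (I : finType) (w Z : I -> R) : is_pmf w ->
  (forall i, 0 < w i -> 0 < Z i) ->
  \sum_i w i * ln (Z i) <= ln (\sum_i w i * Z i).
Proof.
move=> [w0 w1] Z0; set S := \sum_i w i * Z i.
have wZ0 i : 0 <= w i * Z i.
  have := w0 i; rewrite le_eqVlt => /predU1P[<-|wi]; first by rewrite mul0r.
  by rewrite mulr_ge0// ltW// Z0.
have S0 : 0 < S.
  rewrite lt_neqAle sumr_ge0// andbT eq_sym; apply/eqP => /psumr_eq0P S0.
  have : \sum_i w i = 0.
    apply: big1 => i _; apply/eqP; apply/negPn/negP => wi.
    have wi0 : 0 < w i by rewrite lt_neqAle eq_sym wi w0.
    by have := mulr_gt0 wi0 (Z0 _ wi0); rewrite S0 ?ltxx.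
  by rewrite w1 => /eqP; rewrite oner_eq0.
have -> : ln S = \sum_i (w i * (ln S - 1) + w i * Z i / S).
  by rewrite big_split/= -!mulr_suml w1 mul1r divff ?gt_eqF// subrK.
apply: ler_sum => i _.
have := w0 i; rewrite le_eqVlt => /predU1P[<-|wi]; first by rewrite !mul0r addr0.
have Zi := Z0 _ wi.
rewrite -mulrA -mulrDr ler_pM2l// -addrA [-1 + _]addrC -lerBlDl.
by rewrite -ln_div ?posrE// ln_le_subr1// divr_gt0.
Qed.

(** * Affinity and Hellinger distance of two laws *)

Section two_laws.
Context (I : finType) (P Q : I -> R).
Hypotheses (hP : is_pmf P) (hQ : is_pmf Q).
Let P0 := hP.1.
Let Q0 := hQ.1.

(** The Hellinger integral [S_a]. Points with [Q i = 0] contribute [0], which agrees with the Rényi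
    convention at [P i > 0] only for [a < 1]. *)
Definition affinity (a : R) := \sum_i Q i * (P i / Q i) `^ a.
Definition hellinger := \sum_i (Num.sqrt (P i) - Num.sqrt (Q i)) ^+ 2.

Lemma affinity_ge0 a : 0 <= affinity a.
Proof. by apply: sumr_ge0 => i _; rewrite mulr_ge0 ?powR_ge0. Qed.

Lemma affinity_le a : 0 < a -> a < 1 ->
  affinity a <= 1 - (1 - a) * (a * hellinger).
Proof.
move=> a0 a1.
have -> : 1 - (1 - a) * (a * hellinger) = \sum_i (a * P i + (1 - a) * Q i
    - a * (1 - a) * (Num.sqrt (P i) - Num.sqrt (Q i)) ^+ 2).
  by rewrite sumrB big_split/= -!mulr_sumr hP.2 hQ.2 -/hellinger; ring.
by apply: ler_sum => i _; exact: affinity_term_le.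
Qed.

(** Each term is [sqrt P * sqrt Q], so the expansion is exact; [affinity_le] at [1/2] would lose a
    factor 2 on [hellinger]. *)
Lemma affinity_half : affinity 2^-1 = 1 - (1 - 2^-1) * hellinger.
Proof.
have -> : 1 - (1 - 2^-1) * hellinger = \sum_i (2^-1 * P i + 2^-1 * Q i
    - 2^-1 * (Num.sqrt (P i) - Num.sqrt (Q i)) ^+ 2).
  by rewrite sumrB big_split/= -!mulr_sumr hP.2 hQ.2 -/hellinger; field.
apply: eq_bigr => i _.
rewrite powR12_sqrt ?divr_ge0// sqrtrM// sqrtrV//.
rewrite -{1 3}(sqr_sqrtr (Q0 i)) -{2}(sqr_sqrtr (P0 i)).
have [->|yN0] := eqVneq (Num.sqrt (Q i)) 0; last by field.
by rewrite expr0n/= mul0r; field.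
Qed.

(** Cauchy-Schwarz after factoring [P - Q] as [(sqrt P - sqrt Q) (sqrt P + sqrt Q)]. *)
Lemma sqr_tv_le_hellinger :
  (2^-1 * \sum_i `|P i - Q i|) ^+ 2 <= hellinger.
Proof.
set T := 2^-1 * _.
pose x i := Num.sqrt (P i); pose y i := Num.sqrt (Q i).
have T2 : \sum_i `|x i - y i| * (x i + y i) = 2 * T.
  rewrite mulrA divff// mul1r; apply: eq_bigr => i _.
  rewrite -{1}(@ger0_norm _ (x i + y i)) ?addr_ge0 ?sqrtr_ge0// -normrM -subr_sqr.
  by rewrite !sqr_sqrtr.
have s4 : \sum_i (x i + y i) ^+ 2 = 4 - hellinger.
  have -> : 4 = \sum_i (2 * P i + 2 * Q i).
    by rewrite big_split/= -!mulr_sumr hP.2 hQ.2; lra.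
  rewrite -sumrB; apply: eq_bigr => i _.
  rewrite -(sqr_sqrtr (P0 i)) -(sqr_sqrtr (Q0 i)) -/(x i) -/(y i) !sqrtr_sqr.
  by rewrite !ger0_norm ?sqrtr_ge0//; ring.
have H0 : 0 <= hellinger by apply: sumr_ge0 => i _; exact: sqr_ge0.
(* The discriminant argument for Cauchy-Schwarz, at the optimal multiplier up to
   the correction [4 - hellinger <= 4] in the second sum. *)
have : 0 <= \sum_i (`|x i - y i| - T / 2 * (x i + y i)) ^+ 2.
  by apply: sumr_ge0 => i _; exact: sqr_ge0.
have -> : \sum_i (`|x i - y i| - T / 2 * (x i + y i)) ^+ 2 =
    hellinger - T * (2 * T) + T ^+ 2 / 4 * (4 - hellinger).
  rewrite -T2 -s4 !mulr_sumr -sumrB -big_split/=; apply: eq_bigr => i _.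
  by rewrite -/(x i) -/(y i) -(real_normK (num_real (x i - y i))); field.
have : 0 <= T ^+ 2 * hellinger by rewrite mulr_ge0 ?sqr_ge0.
by rewrite !expr2; lra.
Qed.

Hypothesis PQ : forall i, Q i = 0 -> P i = 0.

(** Jensen under [P] with [Z = (P / Q)^(a - 1)]. The sign of [a - 1] is left free, so orders below
    and above 1 are both covered. *)
Lemma mulr_kl_le_ln_affinity a : a != 0 ->
  (a - 1) * (\sum_i P i * ln (P i / Q i)) <= ln (affinity a).
Proof.
move=> a0.
have Q_gt0 i : 0 < P i -> 0 < Q i.
  move=> Pi; rewrite lt_neqAle Q0 andbT eq_sym.
  by apply: contraTneq Pi => /PQ ->; rewrite ltxx.
have -> : affinity a = \sum_i P i * (P i / Q i) `^ (a - 1).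
  apply: eq_bigr => i _.
  have := P0 i; rewrite le_eqVlt => /predU1P[<-|Pi].
    (* Here [a != 0] matters, as [0] to the power [0] is [1]. *)
    by rewrite !mul0r powR0// mulr0.
  have Qi := Q_gt0 _ Pi; have r0 : 0 < P i / Q i by rewrite divr_gt0.
  rewrite powRB ?(gt_eqF r0) ?implybT// powRr1 ?ltW//.
  by field; rewrite !gt_eqF.
rewrite mulr_sumr; under eq_bigr do rewrite mulrCA -ln_powR.
by apply: jensen_ln => // i Pi; rewrite powR_gt0// divr_gt0// Q_gt0.
Qed.

Lemma affinity2 : affinity 2 = 1 + \sum_i (P i - Q i) ^+ 2 / Q i.
Proof.
have -> : 1 + \sum_i (P i - Q i) ^+ 2 / Q i =
    \sum_i (2 * P i - Q i + (P i - Q i) ^+ 2 / Q i).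
  by rewrite big_split/= sumrB -mulr_sumr hP.2 hQ.2; ring.
apply: eq_bigr => i _; rewrite powR_mulrn ?divr_ge0//.
have [Qi|Qi] := eqVneq (Q i) 0; last by field.
by rewrite Qi (PQ Qi) invr0; ring.
Qed.

(** A zero affinity would force [P i = 0] everywhere, by [PQ] where [Q i = 0]. Positivity makes
    [lne] a real logarithm. *)
Lemma affinity_gt0 a : 0 < affinity a.
Proof.
rewrite lt_neqAle affinity_ge0 andbT eq_sym; apply/eqP => /psumr_eq0P S0.
have : \sum_i P i = 0.
  apply: big1 => i _; have [/PQ//|Qi] := eqVneq (Q i) 0.
  have /eqP := S0 (fun i _ => mulr_ge0 (Q0 i) (powR_ge0 _ _)) i isT.
  rewrite mulf_eq0 (negbTE Qi)/= powR_eq0 mulf_eq0 invr_eq0 (negbTE Qi) orbF.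
  by move=> /andP[/eqP].
by rewrite hP.2 => /eqP; rewrite oner_eq0.
Qed.

End two_laws.
End real_inequalities.

(** * Extended-valued divergences of two laws *)

Section divergences_of_two_laws.
Local Open Scope ereal_scope.
Context (R : realType).

(** Homogeneity of degree 1 moves the row weight inside both arguments, infinite terms included. *)
Lemma mule_renyi_term (c a m l : R) : (0 <= c)%R ->
  c%:E * renyi_term a m l = renyi_term a (c * m) (c * l).
Proof.
rewrite le_eqVlt => /predU1P[<-|c0].
  by rewrite mul0e mul0r /renyi_term eqxx.
rewrite /renyi_term !mulf_eq0 (gt_eqF c0)/=.
case: eqVneq => _; first by rewrite mule0.
case: eqVneq => _; first by case: ifPn => _; rewrite ?mule0// gt0_muley.
by rewrite -EFinM mulrA -mulf_div divff ?gt_eqF// mul1r.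
Qed.

Lemma mule_KL_term (c m l : R) : (0 <= c)%R ->
  c%:E * KL_term m l = KL_term (c * m) (c * l).
Proof.
rewrite le_eqVlt => /predU1P[<-|c0].
  by rewrite mul0e mul0r /KL_term eqxx.
rewrite /KL_term !mulf_eq0 (gt_eqF c0)/=.
case: eqVneq => _; first by rewrite mule0.
case: eqVneq => _; first by rewrite gt0_muley.
by rewrite -EFinM mulrA -mulf_div divff ?gt_eqF// mul1r.
Qed.

Lemma renyi_termE (a m l : R) : (a != 0)%R ->
  ((a < 1)%R \/ (l = 0 -> m = 0)%R) ->
  renyi_term a m l = (l * (m / l) `^ a)%:E.
Proof.
move=> a0 hlm; rewrite /renyi_term.
have [->|mN0] := eqVneq m 0%R; first by rewrite mul0r powR0// mulr0.
have [l0|//] := eqVneq l 0%R; rewrite l0 mul0r.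
by case: hlm => [->//|/(_ l0)/eqP]; rewrite (negbTE mN0).
Qed.

(** From [ln S <= S - 1 <= (a - 1) H], dividing by [a - 1 < 0] reverses the order; [S = 0] gives
    [+oo] on the right. *)
Lemma le_mule_lne (a S H : R) : (a < 1)%R -> (0 <= S)%R ->
  (S <= 1 - (1 - a) * H)%R -> H%:E <= (a - 1)^-1%:E * lne S%:E.
Proof.
move=> a1; have a1' : (a - 1 < 0)%R by rewrite subr_lt0.
rewrite le_eqVlt => /predU1P[<- _|S0 SH].
  by rewrite le0_lneNy// lt0_muleNy ?leey// lte_fin invr_lt0.
rewrite lne_EFin// -EFinM lee_fin mulrC ler_ndivlMr//.
by apply: le_trans (ln_le_subr1 S0) _; lra.
Qed.

Context (I : finType) (P Q : I -> R).
Hypotheses (hP : is_pmf P) (hQ : is_pmf Q).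

Lemma sum_renyi_termE (a : R) : (a != 0)%R ->
  ((a < 1)%R \/ forall i, (Q i = 0 -> P i = 0)%R) ->
  \sum_i renyi_term a (P i) (Q i) = (affinity P Q a)%:E.
Proof.
move=> a0 h; rewrite /affinity -sumEFin; apply: eq_bigr => i _.
by apply: renyi_termE => //; case: h => h; [left|right; exact: h].
Qed.

Lemma sum_KL_termE : (forall i, Q i = 0 -> P i = 0)%R ->
  \sum_i KL_term (P i) (Q i) = (\sum_i P i * ln (P i / Q i))%:E.
Proof.
move=> PQ; rewrite -sumEFin; apply: eq_bigr => i _; rewrite /KL_term.
have [->|PN0] := eqVneq (P i) 0%R; first by rewrite mul0r.
by have [/PQ/eqP|//] := eqVneq (Q i) 0%R; rewrite (negbTE PN0).
Qed.

(** Either [P] is absolutely continuous with respect to [Q] and the sums are real, or some point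
    makes those of order at least 1 infinite. *)
Lemma null_sets_dichotomy :
  (forall i, Q i = 0 -> P i = 0)%R \/ exists i, Q i = 0%R /\ P i <> 0%R.
Proof.
have [h|/existsNP[i /not_implyP[Qi Pi]]] :=
  pselect (forall i, Q i = 0 -> P i = 0)%R; [by left|by right; exists i].
Qed.

Lemma sum_KL_term_pinfty i : Q i = 0%R -> P i <> 0%R ->
  \sum_i KL_term (P i) (Q i) = +oo.
Proof.
move=> Qi /eqP Pi; apply/esum_eqyP.
  by move=> j _; rewrite /KL_term; case: ifPn => // _; case: ifPn.
by exists i; rewrite mem_index_enum /KL_term Qi eqxx (negbTE Pi).
Qed.

Lemma sum_renyi_term_pinfty (a : R) i : (1 <= a)%R -> Q i = 0%R -> P i <> 0%R ->
  \sum_i renyi_term a (P i) (Q i) = +oo.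
Proof.
move=> a1 Qi /eqP Pi; apply/esum_eqyP.
  by move=> j _; rewrite /renyi_term; do 3 case: ifPn => // _.
by exists i; rewrite mem_index_enum /renyi_term Qi eqxx (negbTE Pi) ltNge a1.
Qed.

Let KLI := \sum_i KL_term (P i) (Q i).
Let renyiI a := (a - 1)^-1%:E * lne (\sum_i renyi_term a (P i) (Q i)).

Lemma hellinger_le_renyi_half : (hellinger P Q)%:E <= renyiI 2^-1.
Proof.
rewrite /renyiI sum_renyi_termE//; last by left; lra.
by apply: le_mule_lne; rewrite ?affinity_ge0// ?affinity_half//; lra.
Qed.

Lemma mule_hellinger_le_renyi (a : R) : (0 < a)%R -> (a < 1)%R ->
  (a * hellinger P Q)%:E <= renyiI a.
Proof.
move=> a0 a1; rewrite /renyiI sum_renyi_termE ?gt_eqF//; last by left.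
by apply: le_mule_lne; rewrite ?affinity_ge0 ?affinity_le.
Qed.

Lemma renyi_le_KL (a : R) : (0 < a)%R -> (a < 1)%R -> renyiI a <= KLI.
Proof.
move=> a0 a1; rewrite /renyiI /KLI.
have [PQ|[i [Qi Pi]]] := null_sets_dichotomy; last first.
  by rewrite (sum_KL_term_pinfty Qi Pi) leey.
rewrite sum_KL_termE// sum_renyi_termE ?gt_eqF//; last by left.
rewrite lne_EFin ?affinity_gt0// -EFinM lee_fin mulrC ler_ndivrMr ?subr_lt0//.
by rewrite mulrC mulr_kl_le_ln_affinity// gt_eqF.
Qed.

Lemma KL_le_renyi (a : R) : (1 < a)%R -> KLI <= renyiI a.
Proof.
move=> a1; rewrite /renyiI /KLI; have a0 : (0 < a)%R by lra.
have [PQ|[i [Qi Pi]]] := null_sets_dichotomy; last first.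
  rewrite (sum_renyi_term_pinfty (ltW a1) Qi Pi)/= gt0_muley ?leey//.
  by rewrite lte_fin invr_gt0 subr_gt0.
rewrite sum_KL_termE// sum_renyi_termE ?gt_eqF//; last by right.
rewrite lne_EFin ?affinity_gt0// -EFinM lee_fin mulrC ler_pdivlMr ?subr_gt0//.
by rewrite mulrC mulr_kl_le_ln_affinity// gt_eqF.
Qed.

Lemma renyi2_le_chi2 : (forall i, Q i = 0 -> P i = 0)%R ->
  renyiI 2 <= (\sum_i (P i - Q i) ^+ 2 / Q i)%:E.
Proof.
move=> PQ; rewrite /renyiI sum_renyi_termE//; last by right.
have S0 := affinity_gt0 hP hQ PQ 2.
rewrite lne_EFin// -EFinM lee_fin addrK invr1 mul1r.
by apply: le_trans (ln_le_subr1 S0) _; rewrite affinity2// addrAC subrr add0r.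
Qed.

End divergences_of_two_laws.

(** * From transition matrices to laws on pairs *)

Section joint_law.
Local Open Scope ring_scope.
Context (R : realType) (X : finType) (p : X -> R).
Hypothesis hp : is_pmf p.

(** The law of one step of the chain: start from [p], then move by [M]. *)
Definition joint_law (M : X -> X -> R) (i : X * X) := p i.1 * M i.1 i.2.

Lemma joint_law_pmf M : is_transition_matrix M -> is_pmf (joint_law M).
Proof.
move=> hM; split=> [i|]; first by rewrite mulr_ge0 ?hp.1 ?(hM _).1.
rewrite -(pair_bigA _ (fun x y => p x * M x y))/= -hp.2; apply: eq_bigr => x _.
by rewrite -mulr_sumr (hM x).2 mulr1.
Qed.

Variables M L : X -> X -> R.
Hypotheses (hM : is_transition_matrix M) (hL : is_transition_matrix L).

Lemma renyi_joint a : renyi a p M L =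
  if a == 1 then (\sum_i KL_term (joint_law M i) (joint_law L i))%E
  else ((a - 1)^-1%:E *
        lne (\sum_i renyi_term a (joint_law M i) (joint_law L i)))%E.
Proof.
rewrite /renyi /KL; case: ifPn => _; [|congr (_ * lne _)%E];
  rewrite pair_bigA/=; apply: eq_bigr => i _.
- by rewrite mule_KL_term// hp.1.
- by rewrite mule_renyi_term// hp.1.
Qed.

Lemma Hel2_joint : Hel2 p M L = (hellinger (joint_law M) (joint_law L))%:E.
Proof.
rewrite Hel2E// pair_bigA/=; congr (_%:E); apply: eq_bigr => i _.
have p0 := hp.1 i.1.
by rewrite /joint_law !sqrtrM// -mulrBr exprMn sqr_sqrtr.
Qed.

Lemma TV_joint :
  TV p M L = (2^-1 * \sum_i `|joint_law M i - joint_law L i|)%:E.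
Proof.
rewrite TVE// pair_bigA/=; congr (_ * _)%:E; apply: eq_bigr => i _.
by rewrite /joint_law -mulrBr normrM (ger0_norm (hp.1 _)).
Qed.

Lemma renyi2_le_chi2_joint : (renyi 2 p M L <= chi2 p M L)%E.
Proof.
rewrite chi2E//; case: ifPn => [_|]; first exact: leey.
move=> nML; rewrite renyi_joint.
have p0 := hp.1.
have M0 x y : 0 <= M x y by exact: (hM x).1.
have L0 x y : 0 <= L x y by exact: (hL x).1.
(* Finiteness of [chi2] is exactly absolute continuity of the joint laws. *)
have ac i : joint_law L i = 0 -> joint_law M i = 0.
  move=> /eqP; rewrite /joint_law mulf_eq0 => /orP[/eqP ->|Li].
    by rewrite mul0r.
  apply/eqP; apply: contraNT nML => Mi; apply/existsP; exists i.1.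
  by apply/existsP; exists i.2; rewrite Li andbT lt_neqAle eq_sym Mi mulr_ge0.
have -> : \sum_x \sum_(y | 0 < L x y) p x * ((M x y - L x y) ^+ 2 / L x y) =
    \sum_i (joint_law M i - joint_law L i) ^+ 2 / joint_law L i.
  under eq_bigr do rewrite big_mkcond/=.
  rewrite pair_bigA/=; apply: eq_bigr => i _.
  (* Where [p] or [L] vanishes, the joint quotient is a division by [0], hence [0]. *)
  have [p_0|pi] := eqVneq (p i.1) 0.
    by rewrite /joint_law p_0 !mul0r if_same subrr expr0n mul0r.
  case: ifPn => [Li|]; first by rewrite /joint_law; field; rewrite pi gt_eqF.
  rewrite lt_neqAle L0 andbT eq_sym negbK => /eqP Li.
  by rewrite /joint_law Li mulr0 invr0 mulr0.
by rewrite gt_eqF ?ltr1n//; apply: renyi2_le_chi2 => //; exact: joint_law_pmf.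
Qed.

End joint_law.

(** * Comparison chain and Pinsker's inequality *)

Local Open Scope ereal_scope.

Theorem proposition3p5 (R : realType) (X : finType) (p : X -> R)
    (M L : X -> X -> R)
    (hp : is_pmf p) (hM : is_transition_matrix M)
    (hL : is_transition_matrix L) :
  [/\ Hel2 p M L <= renyi (2^-1)%R p M L,
      renyi (2^-1)%R p M L <= renyi 1%R p M L,
      renyi 1%R p M L <= renyi 2%R p M L &
      renyi 2%R p M L <= chi2 p M L]
  /\
  (forall a : R, (0 < a)%R -> (a <= 1)%R ->
     (a / 2)%:E * TV p M L ^+ 2 <= renyi a p M L).
Proof.
have hP := joint_law_pmf hp hM; have hQ := joint_law_pmf hp hL.
have half0 : (0 < 2^-1 :> R)%R by lra.
have half1 : (2^-1 < 1 :> R)%R by lra.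
have two1 : (1 < 2 :> R)%R by lra.
have Hel2_le : Hel2 p M L <= renyi (2^-1)%R p M L.
  by rewrite Hel2_joint// renyi_joint// lt_eqF// hellinger_le_renyi_half.
have half_le : renyi (2^-1)%R p M L <= renyi 1%R p M L.
  by rewrite !renyi_joint// lt_eqF// eqxx renyi_le_KL.
split; first split=> //.
- by rewrite !renyi_joint// eqxx gt_eqF// KL_le_renyi.
- exact: renyi2_le_chi2_joint.
move=> a a0; have := sqr_tv_le_hellinger hP hQ.
rewrite TV_joint// -EFin_expe -EFinM; set T := (_ ^+ 2)%R => TH.
have T0 : (0 <= T)%R by rewrite sqr_ge0.
rewrite le_eqVlt => /predU1P[->|a1].
  (* Order 1 goes through order [1/2]: [TV^2 / 2 <= Hel2 <= R_(1/2) <= R_1]. *)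
  apply: le_trans (le_trans Hel2_le half_le).
  by rewrite Hel2_joint// lee_fin; lra.
(* The factor [1/2] is slack, since [TV^2 <= Hel2] already holds. *)
apply: (@le_trans _ _ (a * hellinger (joint_law p M) (joint_law p L))%:E).
  by rewrite lee_fin -mulrA ler_pM2l//; lra.
by rewrite renyi_joint// lt_eqF// mule_hellinger_le_renyi.
Qed.
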